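(* Let $n>1$ be an odd integer, let $r\geqslant 1$, and let $d\in\{1,2\}$. Then, modulo \[ [n^r]\prod_{j=0}^{(n^{r-1}-1)/d}(1-aq^{(2j+1)n})(a-q^{(2j+1)n}), \] we have \[ \sum_{k=0}^{(n^r-1)/d}[4k+1]\frac{(aq;q^2)_k (q/a;q^2)_k(q;q^2)_k^2} {(aq^2;q^2)_k (q^2/a;q^2)_k(q^2;q^2)_k^2} \equiv q^{(1-n)/2} [n] \sum_{k=0}^{(n^{r-1}-1)/d}[4k+1]_{q^n} \frac{(aq^n;q^{2n})_k (q^n/a;q^{2n})_k(q^{n};q^{2n})_k^2} {(aq^{2n};q^{2n})_k (q^{2n}/a;q^{2n})_k(q^{2n};q^{2n})_k^2}. \]
   Context: Here $a$ is an indeterminate and both sides are rational functions in $q$ and $a$. Notation: $(x;q)_k=(1-x)(1-xq)\cdots(1-xq^{k-1})$ (with $(x;q)_0=1$) is the $q$-shifted factorial; $[m]=[m]_q=1+q+\cdots+q^{m-1}$ is the $q$-integer, and $[m]_{q^n}=1+q^n+\cdots+q^{n(m-1)}$. For rational functions $A,B$ in $q,a$ and a polynomial $P$ in $q,a$, $A\equiv B\pmod{P}$ means that $A-B$ can be written as a quotient of polynomials whose numerator is divisible by $P$ and whose denominator is relatively prime to $P$. *)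

(* Defs.v *)
From HB Require Import structures.
From mathcomp Require Import all_boot all_order all_algebra.
Set Implicit Arguments. Unset Strict Implicit. Unset Printing Implicit Defensive.
Import Order.TTheory GRing.Theory Num.Theory.
Local Open Scope ring_scope.

(* Bivariate polynomials over Q: outer variable q, inner variable a. *)
Definition Pqa := {poly {poly rat}}.
Definition Kqa := {fraction Pqa}.

Definition toK (p : Pqa) : Kqa := FracField.tofrac p.

Definition qP : Pqa := 'X.
Definition aP : Pqa := ('X : {poly rat})%:P.
Definition qK : Kqa := toK qP.
Definition aK : Kqa := toK aP.

Definition qpoch (x y : Kqa) (k : nat) : Kqa := \prod_(i < k) (1 - x * y ^+ i).

Definition qint (Q : Kqa) (m : nat) : Kqa := \sum_(i < m) Q ^+ i.

Definition summand (Q : Kqa) (k : nat) : Kqa :=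
  qint Q (4 * k + 1) *
  (qpoch (aK * Q) (Q ^+ 2) k * qpoch (Q / aK) (Q ^+ 2) k * qpoch Q (Q ^+ 2) k ^+ 2) /
  (qpoch (aK * Q ^+ 2) (Q ^+ 2) k * qpoch (Q ^+ 2 / aK) (Q ^+ 2) k
     * qpoch (Q ^+ 2) (Q ^+ 2) k ^+ 2).

Definition qsum (Q : Kqa) (N : nat) : Kqa := \sum_(k < N.+1) summand Q k.

Definition pdivides (M N : Pqa) : Prop := exists C : Pqa, N = M * C.
Definition rel_prime (D M : Pqa) : Prop :=
  forall c : Pqa, pdivides c D -> pdivides c M -> c \is a GRing.unit.
Definition congr_mod (A B : Kqa) (M : Pqa) : Prop :=
  exists N D : Pqa, D != 0 /\ A - B = toK N / toK D /\ pdivides M N /\ rel_prime D M.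

Definition modulus (n r d : nat) : Pqa :=
  (\sum_(i < n ^ r) qP ^+ i) *
  \prod_(j < ((n ^ r.-1 - 1) %/ d).+1)
     ((1 - aP * qP ^+ ((2 * j + 1) * n)) * (aP - qP ^+ ((2 * j + 1) * n))).

(* Main.v *)
(* The modulus factors as the product of the cyclotomic Phi_e(q), e | n^r, e > 1,
   and of the 1 - a q^m and a - q^m with m = (2j+1)n. Each factor P generates the
   kernel of a specialization of Q[a][q] to a field, and prime avoidance reduces the
   congruence to the vanishing of the difference of both sides under each of them.

   At a = q^m or q^-m, m = 2j+1 (in the base Q = q or q^n), the sums are terminating
   very-well-poised 6phi5 series; a WZ argument raising m by 2 gives the value
   q^-j [m], and the two sides agree.

   At a primitive e-th root of unity w, e = 2h+1, the k-th coefficient for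
   k = l e + s is a constant depending on l times the coefficient for s; the terms
   with h < s < e vanish, and those with s <= h cancel in pairs s <-> h - s. So each
   side vanishes separately, unless q^n is specialized to 1, where the factor [n]
   vanishes and the sum over base q^n stays finite. *)
Require Import Defs.
From HB Require Import structures.
From mathcomp Require Import all_boot all_order all_algebra.
From mathcomp Require Import all_field ring zify.
Import GRing.Theory.
Set Implicit Arguments. Unset Strict Implicit. Unset Printing Implicit Defensive.
Local Open Scope ring_scope.

(** * Very-well-poised sums *)

Section WellPoised.
Variable F : fieldType.
Implicit Types a Q x : F.

(** The four factors met at one index of the summand: [x] is an odd power of [Q] in the numerator
    and an even power in the denominator. *)
Definition wpfactor a x : F := (1 - a * x) * (1 - x / a) * (1 - x) ^+ 2.

Definition wpratio a Q i : F :=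
  wpfactor a (Q ^+ (2 * i + 1)) / wpfactor a (Q ^+ (2 * i + 2)).

Definition wpcoef a Q k : F := \prod_(i < k) wpratio a Q i.

Definition wpsum a Q N : F :=
  \sum_(k < N) (1 - Q ^+ (4 * k + 1)) / (1 - Q) * wpcoef a Q k.

Lemma wpfactorV a x : wpfactor a^-1 x = wpfactor a x.
Proof. by rewrite /wpfactor invrK [a^-1 * x]mulrC [x * a]mulrC [X in X * _]mulrC. Qed.

Lemma wpcoefV a Q k : wpcoef a^-1 Q k = wpcoef a Q k.
Proof. by apply: eq_bigr => i _; rewrite /wpratio !wpfactorV. Qed.

Lemma wpsumV a Q N : wpsum a^-1 Q N = wpsum a Q N.
Proof. by apply: eq_bigr => i _; rewrite wpcoefV. Qed.

Lemma wpcoefS a Q k : wpcoef a Q k.+1 = wpcoef a Q k * wpratio a Q k.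
Proof. by rewrite /wpcoef big_ord_recr. Qed.

Lemma wpcoef0 a Q : wpcoef a Q 0 = 1.
Proof. by rewrite /wpcoef big_ord0. Qed.

Lemma wpcoef_eq0 a Q j k :
  wpfactor a (Q ^+ (2 * j + 1)) = 0 -> (j < k)%N -> wpcoef a Q k = 0.
Proof.
move=> h jk; rewrite /wpcoef (bigD1 (Ordinal jk)) //= /wpratio h.
by rewrite !mul0r.
Qed.

Lemma wpfactor_neq0 a x :
  1 - a * x != 0 -> 1 - x / a != 0 -> 1 - x != 0 -> wpfactor a x != 0.
Proof. by move=> h1 h2 h3; rewrite !mulf_neq0. Qed.

(** The factors [1 - a * x] and [1 - x / a] exchange roles under inversion of [x]. At a root of
    unity this symmetry reverses the product of the ratios. *)
Lemma wpfactor_inv a x : a != 0 -> x != 0 ->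
  wpfactor a x^-1 = x ^- 4 * wpfactor a x.
Proof. by move=> a0 x0; rewrite /wpfactor; field; rewrite a0. Qed.

Lemma wpratioE a Q i : wpratio a Q i =
  (1 - a * Q * (Q ^+ 2) ^+ i) * (1 - Q * (Q ^+ 2) ^+ i / a)
     * (1 - Q * (Q ^+ 2) ^+ i) ^+ 2 /
  ((1 - a * Q ^+ 2 * (Q ^+ 2) ^+ i) * (1 - Q ^+ 2 * (Q ^+ 2) ^+ i / a)
     * (1 - Q ^+ 2 * (Q ^+ 2) ^+ i) ^+ 2).
Proof.
have E j : Q ^+ (2 * i + j) = Q ^+ j * (Q ^+ 2) ^+ i by rewrite exprD -exprM mulrC.
by rewrite /wpratio /wpfactor !E expr1 !mulrA.
Qed.

Section Shift.
Variables a Q : F.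
Hypotheses (Q0 : Q != 0) (a0 : a != 0).
Hypothesis (hQ : forall i, 1 - Q ^+ 2 * (Q ^+ 2) ^+ i != 0).
Hypothesis (haQ : forall i, 1 - a * (Q ^+ 2) ^+ i != 0).
Hypothesis (hQa : forall i, 1 - Q ^+ 2 * (Q ^+ 2) ^+ i / a != 0).
Hypothesis (aQ1 : 1 - a * Q != 0).

(** Replacing [a] by [a * Q ^+ 2] moves the factors in [a * x] one index up and those in [x / a] one
    index down, so the quotient of the two products telescopes to boundary factors. *)
Lemma wpcoef_shift k : let x := (Q ^+ 2) ^+ k in
  wpcoef (a * Q ^+ 2) Q k.+1 = wpcoef a Q k *
   ((1 - a * Q * x) * (1 - a * Q ^+ 3 * x) / (1 - a * Q) * (1 - Q^-1 / a)
     * (1 - Q * x) ^+ 2 * (1 - a * Q ^+ 2)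
    / ((1 - a * Q ^+ 2 * x) * (1 - a * Q ^+ 4 * x) * (1 - a^-1)
       * (1 - Q ^+ 2 * x) ^+ 2)).
Proof.
have h1 : 1 - a != 0 by have := haQ 0; rewrite expr0 mulr1.
have h1' : a - 1 != 0 by rewrite -opprB oppr_eq0.
have h2 : 1 - a * Q ^+ 2 != 0 by have := haQ 1; rewrite expr1.
have h3 : 1 - a * Q ^+ 4 != 0 by have := haQ 2; rewrite -exprM.
have h4 : 1 - Q ^+ 2 != 0 by have := hQ 0; rewrite expr0 mulr1.
elim: k => [|k IH] /=.
  rewrite wpcoefS !wpcoef0 wpratioE !expr0; field.
  by rewrite ?a0 ?Q0 ?aQ1 ?h1 ?h1' ?h2 ?h3 ?h4.
rewrite wpcoefS IH /= wpcoefS !wpratioE exprS.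
have := hQ k; have := hQ k.+1; have := haQ k.+1; have := haQ k.+2; have := haQ k.+3.
have := hQa k; rewrite !(exprS (Q ^+ 2)).
set x := (Q ^+ 2) ^+ k.
move=> g1 g2 g3 g4 g5 g6.
have g1' : a - Q ^+ 2 * x != 0.
  by apply: contraNneq g1 => e; rewrite -(mulfK a0 1) -mulrBl mul1r e mul0r.
have E2 : a * (Q ^+ 2 * (Q ^+ 2 * (Q ^+ 2 * x))) = a * Q ^+ 4 * (Q ^+ 2 * x) by ring.
have E3 : a * (Q ^+ 2 * (Q ^+ 2 * x)) = a * Q ^+ 2 * (Q ^+ 2 * x) by ring.
rewrite E2 in g2; rewrite E3 in g3; rewrite mulrA in g4.
field; rewrite -!expr2.
by rewrite a0 g5 h1' g2 g3 Q0 aQ1 g6 g1' g4.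
Qed.


(* At [a = Q ^+ (2 * j + 1)] the closed form is [Q ^- j * (1 - a)], so the left-hand
   side should vanish for large [K]; it telescopes, and [wpcoef a Q K = 0] for [j < K]. *)
Lemma wpsum_shift K :
  Q * (1 - a) * (\sum_(k < K.+1) (1 - Q ^+ (4 * k + 1)) * wpcoef (a * Q ^+ 2) Q k)
  - (1 - a * Q ^+ 2) * (\sum_(k < K.+1) (1 - Q ^+ (4 * k + 1)) * wpcoef a Q k)
  = let x := (Q ^+ 2) ^+ K in
    - (1 + a * Q) * (1 - a * Q ^+ 2) / (1 - a * Q) * wpcoef a Q K
      * (1 - Q * x) ^+ 2 * (1 - a * Q * x) / (1 - a * Q ^+ 2 * x).
Proof.
have h1 : 1 - a != 0 by have := haQ 0; rewrite expr0 mulr1.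
have h1' : a - 1 != 0 by rewrite -opprB oppr_eq0.
have h2 : 1 - a * Q ^+ 2 != 0 by have := haQ 1; rewrite expr1.
elim: K => [|K IH] /=.
  rewrite !big_ord_recl !big_ord0 !wpcoef0 !expr0; field.
  by rewrite h2 aQ1.
rewrite big_ord_recr [in X in _ - X]big_ord_recr /=.
have distr (c c' s t s' t' : F) :
  c * (s + t) - c' * (s' + t') = (c * s - c' * s') + (c * t - c' * t') by ring.
rewrite distr IH /= wpcoef_shift wpcoefS wpratioE.
have -> : Q ^+ (4 * K.+1 + 1) = Q ^+ 5 * ((Q ^+ 2) ^+ K) ^+ 2.
  by rewrite -!exprM -exprD; congr (_ ^+ _); lia.
have := hQ K; have := haQ K.+1; have := haQ K.+2.
have := hQa K; rewrite !(exprS (Q ^+ 2)).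
set x := (Q ^+ 2) ^+ K.
move=> g1 g2 g3 g4.
have g1' : a - Q ^+ 2 * x != 0.
  by apply: contraNneq g1 => e; rewrite -(mulfK a0 1) -mulrBl mul1r e mul0r.
rewrite mulrA in g2; rewrite mulrA in g3.
field.
by rewrite g2 a0 g4 g1' g3 aQ1 h1' Q0.
Qed.

End Shift.

(** Induction on [j]: at [a = Q] only the term [k = 0] survives, and the shift identity passes from
    [a] to [a * Q ^+ 2]. *)
Lemma wpsum_terminating Q j N : Q != 0 -> (forall k, (0 < k)%N -> Q ^+ k != 1) ->
  (j < N)%N -> wpsum (Q ^+ (2 * j + 1)) Q N = Q ^- j * (1 - Q ^+ (2 * j + 1)) / (1 - Q).
Proof.
move=> Q0 Qn1 jN.
have Qn1' k : (0 < k)%N -> 1 - Q ^+ k != 0.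
  by move=> k0; rewrite subr_eq0 eq_sym Qn1.
suff H : \sum_(k < N) (1 - Q ^+ (4 * k + 1)) * wpcoef (Q ^+ (2 * j + 1)) Q k
    = Q ^- j * (1 - Q ^+ (2 * j + 1)).
  rewrite -H mulr_suml; apply: eq_bigr => k _; exact: mulrAC.
have zero i : wpfactor (Q ^+ (2 * i + 1)) (Q ^+ (2 * i + 1)) = 0.
  by rewrite /wpfactor divff ?expf_neq0 // subrr mulr0 mul0r.
elim: j N jN => [|j IH] [//|N] jN.
  rewrite big_ord_recl big1 ?wpcoef0 ?expr0 ?invr1 ?mulr1 ?mul1r ?addr0 // => i _.
  by rewrite (wpcoef_eq0 (zero 0%N)) ?mulr0.
set a := Q ^+ (2 * j + 1).
have Ea : Q ^+ (2 * j.+1 + 1) = a * Q ^+ 2 by rewrite -exprD; congr (_ ^+ _); lia.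
have a0 : a != 0 by rewrite expf_neq0.
have ha i : 1 - a * (Q ^+ 2) ^+ i != 0 by rewrite -exprM -exprD Qn1' //; lia.
have haQ : 1 - a * Q != 0 by rewrite -exprSr Qn1'.
(* Here [j < N], so the boundary term, a multiple of [wpcoef a Q N], vanishes and the sums at [a]
   and [a * Q ^+ 2] become proportional. *)
have := fun h1 h2 => @wpsum_shift a Q Q0 a0 h1 ha h2 haQ N.
rewrite (wpcoef_eq0 (zero j)) // Ea => H; rewrite /= !(mulr0, mul0r) in H.
have h1 : 1 - a != 0 by have := ha 0; rewrite expr0 mulr1.
apply: (mulfI (mulf_neq0 Q0 h1)).
rewrite (subr0_eq (H _ _)).
- rewrite IH 1?ltnW // -/a [Q ^+ j.+1]exprS; field.
  by rewrite Q0 expf_neq0.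
- by move=> i; rewrite -exprM -exprD Qn1'.
(* [a] is an odd power of [Q], hence different from every even power; the smaller exponent is
   factored out. *)
move=> i; rewrite -[1](divff a0) -mulrBl mulf_neq0 ?invr_eq0 //.
rewrite -exprM -exprD /a subr_eq0.
have shift u v : (0 < v)%N -> Q ^+ u != Q ^+ (u + v).
  by move=> v0; rewrite exprD -subr_eq0 -{1}[Q ^+ u]mulr1 -mulrBr mulf_neq0 ?expf_neq0 ?Qn1'.
have [le|le] := leqP (2 * j + 1) (2 + 2 * i).
  have -> : (2 + 2 * i = 2 * j + 1 + (2 * i + 1 - 2 * j))%N by lia.
  by apply: shift; lia.
have -> : (2 * j + 1 = 2 + 2 * i + (2 * j - 1 - 2 * i))%N by lia.
by rewrite eq_sym; apply: shift; lia.
Qed.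

End WellPoised.

(** * Coefficients and half sums at a primitive root of unity of odd order *)

Section RootOfUnity.
Variables (F : fieldType) (a w : F) (h : nat).
Local Notation e := (h.*2.+1).
Hypotheses (w_prim : e.-primitive_root w) (a0 : a != 0).
Hypothesis (haw : forall i, 1 - a * w ^+ i != 0).
Hypothesis (hwa : forall i, 1 - w ^+ i / a != 0).

Lemma prim_root_neq0 : w != 0.
Proof.
apply/eqP => w0; have := prim_expr_order w_prim.
by rewrite w0 exprS mul0r => /eqP; rewrite eq_sym oner_eq0.
Qed.
Local Notation w0 := prim_root_neq0.

Lemma wpfactor_prim_neq0 m : ~~ (e %| m)%N -> wpfactor a (w ^+ m) != 0.
Proof.
move=> em; apply: wpfactor_neq0 => //.
by rewrite subr_eq0 eq_sym -(prim_order_dvd w_prim).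
Qed.

(** As [e] is odd, it divides [2 * i.+1] only if it divides [i.+1]. *)
Lemma wpfactor_even_neq0 i : (i.+1 < e)%N -> wpfactor a (w ^+ (2 * i + 2)) != 0.
Proof.
move=> ie; apply: wpfactor_prim_neq0.
have -> : (2 * i + 2 = 2 * i.+1)%N by lia.
rewrite Gauss_dvdr ?coprimen2 /= ?odd_double //.
by apply/negP => /dvdn_leq; lia.
Qed.

Lemma prim_expB m k : (m + k = e)%N -> w ^+ m = (w ^+ k)^-1.
Proof.
move=> mk; apply: (mulIf (expf_neq0 k w0)).
by rewrite -exprD mk (prim_expr_order w_prim) mulVf // expf_neq0 // w0.
Qed.

(** Since [2 * (h - i.+1) + 2] and [2 * i + 1] add up to [e], the reversed denominators are the
    numerators up to powers of [w], and only a power of [w] is left. *)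
Lemma wpcoef_half : wpcoef a w h = w.
Proof.
rewrite /wpcoef /wpratio big_split /= prodfV.
rewrite (reindex_inj rev_ord_inj (F := fun i : 'I_h => wpfactor a (w ^+ (2 * i + 2)))) /=.
have -> : \prod_(i < h) wpfactor a (w ^+ (2 * (h - i.+1) + 2))
   = \prod_(i < h) (w ^+ (2 * i + 1)) ^- 4 * \prod_(i < h) wpfactor a (w ^+ (2 * i + 1)).
  rewrite -big_split; apply: eq_bigr => i _ /=.
  rewrite (@prim_expB _ (2 * i + 1)); last by have := ltn_ord i; lia.
  by rewrite wpfactor_inv // expf_neq0 // w0.
rewrite prodfV invfM invrK mulrCA divff ?mulr1; last first.
  apply/prodf_neq0 => i _; apply: wpfactor_prim_neq0.
  by apply/negP => /dvdn_leq; have := ltn_ord i; lia.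
have -> k : \prod_(i < k) (w ^+ (2 * i + 1)) ^+ 4 = w ^+ (4 * (k * k)).
  elim: k => [|k IH]; first by rewrite big_ord0.
  by rewrite big_ord_recr /= IH -exprM -exprD; congr (_ ^+ _); lia.
(* The power is [w ^+ (4 * (h * h))]; multiplying by [w ^+ e = 1] makes the exponent congruent to 1
   modulo [e]. *)
rewrite -[LHS]mulr1 -(prim_expr_order w_prim) -exprD.
have -> : (4 * (h * h) + e = e * h.*2 + 1)%N by lia.
by rewrite exprD exprM (prim_expr_order w_prim) expr1n mul1r.
Qed.

(** By inversion, the ratio of index [h - k.+1] is [w ^- 4] times the inverse of the ratio of index
    [k]; the induction starts from [wpcoef_half]. *)
Lemma wpcoef_rev k : (k <= h)%N -> wpcoef a w (h - k) = w ^+ (4 * k + 1) * wpcoef a w k.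
Proof.
elim: k => [|k IH] kh; first by rewrite subn0 wpcoef_half wpcoef0 mulr1.
have := IH (ltnW kh).
have -> : (h - k = (h - k.+1).+1)%N by lia.
rewrite !wpcoefS /wpratio.
rewrite (@prim_expB _ (2 * k + 2)); last by lia.
rewrite (@prim_expB (2 * (h - k.+1) + 2) (2 * k + 1)); last by lia.
rewrite !wpfactor_inv ?expf_neq0 ?w0 //.
have -> : w ^+ (4 * k.+1 + 1) = w ^+ (4 * k + 1) * w ^+ 4.
  by rewrite -exprD; congr (_ ^+ _); lia.
have Ey : w ^+ (2 * k + 2) = w ^+ (2 * k + 1) * w by rewrite -exprSr; congr (_ ^+ _); lia.
have : wpfactor a (w ^+ (2 * k + 2)) != 0 by apply: wpfactor_even_neq0; lia.
have : wpfactor a (w ^+ (2 * k + 1)) != 0.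
  by apply: wpfactor_prim_neq0; apply/negP => /dvdn_leq; lia.
rewrite Ey; have := expf_neq0 (2 * k + 1) w0.
move: (wpfactor a _) (wpfactor a (_ * _)) => A B.
move: (w ^+ (2 * k + 1)) => y y0 A0 B0.
move: (w ^+ (4 * k + 1)) (wpcoef a w _) (wpcoef a w k) => z u v E.
have -> : u = z * v * w ^+ 4 * A / B; last by field.
rewrite -E; field; by rewrite A0 y0 w0 B0.
Qed.

(** With [z = w ^+ (4 * i + 1)], reversal turns [1 - z] into [1 - z^-1] and multiplies the
    coefficient by [z], so the sum equals its own negative. *)
Lemma wpsum_half : (2 : F) != 0 -> wpsum a w h.+1 = 0.
Proof.
move=> two.
suff E : wpsum a w h.+1 = - wpsum a w h.+1.
  by apply: (mulfI two); rewrite mulr0 mulr_natl mulr2n {2}E subrr.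
rewrite {1}/wpsum (reindex_inj rev_ord_inj) /= -sumrN.
apply: eq_bigr => i _.
have ih : (i <= h)%N by rewrite -ltnS.
rewrite subSS wpcoef_rev //.
have : w ^+ (4 * (h - i) + 1) = (w ^+ (4 * i + 1))^-1.
  apply: (mulIf (expf_neq0 (4 * i + 1) w0)).
  rewrite mulVf ?expf_neq0 ?w0 // -exprD.
  have -> : (4 * (h - i) + 1 + (4 * i + 1) = e * 2)%N by lia.
  by rewrite exprM (prim_expr_order w_prim) expr1n.
move=> ->; have := expf_neq0 (4 * i + 1) w0.
move: (w ^+ (4 * i + 1)) => z z0.
rewrite mulrA -mulNr; congr (_ * _).
rewrite mulrAC -mulNr; congr (_ * _).
by field.
Qed.

(** The numerator of index [h] is evaluated at [w ^+ e = 1]. *)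
Lemma wpcoef_tail_eq0 k : (h < k)%N -> wpcoef a w k = 0.
Proof.
move=> hk; apply: (wpcoef_eq0 (j := h)) => //.
have -> : (2 * h + 1 = e)%N by lia.
by rewrite (prim_expr_order w_prim) /wpfactor subrr expr0n mulr0.
Qed.

End RootOfUnity.

(** * Specialization of rational functions *)

Local Notation "x %:F" := (@FracField.tofrac _ x).

Section Specialization.
Variables (A : idomainType) (L : fieldType) (phi : {rmorphism A -> L}).
Implicit Types (x y : {fraction A}) (u v : L).

(** A relation rather than a function: [phi] extends only to fractions having a denominator outside
    its kernel, the localization at that kernel. *)
Definition specializes x v : Prop :=
  exists N D : A, [/\ phi D != 0, x = N%:F / D%:F & v = phi N / phi D].

Lemma phi_neq0 D : phi D != 0 -> D != 0.
Proof. by apply: contraNneq => ->; rewrite rmorph0. Qed.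

Lemma specializes_tofrac N : specializes N%:F (phi N).
Proof. by exists N, 1; split; rewrite ?rmorph1 ?oner_eq0 ?divr1. Qed.

Lemma specializes0 : specializes 0 0.
Proof. by have := specializes_tofrac 0; rewrite !rmorph0. Qed.

Lemma specializes1 : specializes 1 1.
Proof. by have := specializes_tofrac 1; rewrite !rmorph1. Qed.

Lemma specializesD x y u v :
  specializes x u -> specializes y v -> specializes (x + y) (u + v).
Proof.
move=> [N [D [d0 -> ->]]] [N' [D' [d0' -> ->]]].
exists (N * D' + N' * D), (D * D').
have D0 := phi_neq0 d0; have D0' := phi_neq0 d0'.
split; first by rewrite rmorphM mulf_neq0.
  by rewrite rmorphD !rmorphM addf_div ?tofrac_eq0.
by rewrite rmorphD !rmorphM addf_div.
Qed.

Lemma specializesM x y u v :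
  specializes x u -> specializes y v -> specializes (x * y) (u * v).
Proof.
move=> [N [D [d0 -> ->]]] [N' [D' [d0' -> ->]]].
exists (N * N'), (D * D').
by split; rewrite !rmorphM ?mulf_neq0 // mulf_div.
Qed.

Lemma specializesN x u : specializes x u -> specializes (- x) (- u).
Proof.
move=> [N [D [d0 -> ->]]]; exists (- N), D.
by split; rewrite // rmorphN mulNr.
Qed.

Lemma specializesB x y u v :
  specializes x u -> specializes y v -> specializes (x - y) (u - v).
Proof. by move=> hx /specializesN; apply: specializesD. Qed.

Lemma specializesV x u : u != 0 -> specializes x u -> specializes x^-1 u^-1.
Proof.
move=> u0 [N [D [d0 -> E]]]; move: u0; rewrite E => u0.
exists D, N; split; rewrite ?invf_div //.
by apply: contraNneq u0 => ->; rewrite mul0r.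
Qed.

Lemma specializes_div x y u v : v != 0 ->
  specializes x u -> specializes y v -> specializes (x / y) (u / v).
Proof. by move=> v0 hx hy; apply: specializesM => //; apply: specializesV. Qed.

Lemma specializesX x u n : specializes x u -> specializes (x ^+ n) (u ^+ n).
Proof.
move=> hx; elim: n => [|n IH]; first exact: specializes1.
by rewrite !exprS; apply: specializesM.
Qed.

Lemma specializes_sum n (f : nat -> {fraction A}) (g : nat -> L) :
  (forall i, (i < n)%N -> specializes (f i) (g i)) ->
  specializes (\sum_(i < n) f i) (\sum_(i < n) g i).
Proof.
elim: n => [|n IH] H; first by rewrite !big_ord0; apply: specializes0.
rewrite !big_ord_recr; apply: specializesD; last exact: H.
by apply: IH => i /ltnW; apply: H.
Qed.

Lemma specializes_prod n (f : nat -> {fraction A}) (g : nat -> L) :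
  (forall i, (i < n)%N -> specializes (f i) (g i)) ->
  specializes (\prod_(i < n) f i) (\prod_(i < n) g i).
Proof.
elim: n => [|n IH] H; first by rewrite !big_ord0; apply: specializes1.
rewrite !big_ord_recr; apply: specializesM; last exact: H.
by apply: IH => i /ltnW; apply: H.
Qed.

Lemma specializes_wpfactor a Q al u : al != 0 ->
  specializes a al -> specializes Q u ->
  specializes (wpfactor a Q) (wpfactor al u).
Proof.
move=> al0 ha hQ; have h1 := specializes1.
apply: specializesM; last by apply: specializesX; apply: specializesB.
apply: specializesM; apply: specializesB => //; first exact: specializesM.
exact: specializes_div.
Qed.

Lemma specializes_wpratio a Q al u i : al != 0 ->
  wpfactor al (u ^+ (2 * i + 2)) != 0 ->
  specializes a al -> specializes Q u ->
  specializes (wpratio a Q i) (wpratio al u i).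
Proof.
move=> al0 nz ha hQ.
by apply: specializes_div nz _ _; apply: specializes_wpfactor => //;
  apply: specializesX.
Qed.

Lemma specializes_wpsum a Q al u n : al != 0 -> 1 - u != 0 ->
  (forall i, wpfactor al (u ^+ (2 * i + 2)) != 0) ->
  specializes a al -> specializes Q u ->
  specializes (wpsum a Q n) (wpsum al u n).
Proof.
move=> al0 u1 nz ha hQ; have h1 := specializes1.
apply: (specializes_sum (f := fun k => (1 - Q ^+ (4 * k + 1)) / (1 - Q) * wpcoef a Q k)
  (g := fun k => (1 - u ^+ (4 * k + 1)) / (1 - u) * wpcoef al u k)) => k _.
apply: specializesM.
  by apply: specializes_div => //; apply: specializesB => //; apply: specializesX.
by apply: (specializes_prod (f := wpratio a Q) (g := wpratio al u)) => i _;
  apply: specializes_wpratio.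
Qed.

End Specialization.

(** * The coefficients expressed by Gauss binomials *)

Section GaussBinomial.
Variables (F : fieldType) (a Q : F).

Definition qfact k : F := \prod_(i < k) (1 - Q ^+ i.+1).
Definition qfact_plus k : F := \prod_(i < k) (1 + Q ^+ i.+1).

(** The factors of [wpcoef] that involve [a]; the remaining ones can become 0/0 at a root of unity
    and need the Gauss binomial. *)
Definition wpcoef_outer k : F :=
  \prod_(i < k) ((1 - a * Q ^+ (2 * i + 1)) * (1 - Q ^+ (2 * i + 1) / a)
    / ((1 - a * Q ^+ (2 * i + 2)) * (1 - Q ^+ (2 * i + 2) / a))).

Lemma qfactS k : qfact k.+1 = qfact k * (1 - Q ^+ k.+1).
Proof. by rewrite /qfact big_ord_recr. Qed.

(** Pascal's rule, with the binomials [g] and [g'] given as cofactors instead of quotients. It comes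
    from splitting [1 - Q ^+ (m + k.+2)] as [(1 - Q ^+ k.+1) + Q ^+ k.+1 * (1 - Q ^+ m.+1)]. *)
Lemma qfact_pascal m k g g' :
  qfact (m.+1 + k) = g * (qfact m.+1 * qfact k) ->
  qfact (m + k.+1) = g' * (qfact m * qfact k.+1) ->
  qfact (m.+1 + k.+1) = (g + Q ^+ k.+1 * g') * (qfact m.+1 * qfact k.+1).
Proof.
move=> Eg Eg'; have -> : (m.+1 + k.+1 = (m + k.+1).+1)%N by lia.
rewrite qfactS.
have -> : 1 - Q ^+ (m + k.+1).+1 = (1 - Q ^+ k.+1) + Q ^+ k.+1 * (1 - Q ^+ m.+1).
  by rewrite mulrBr mulr1 -exprD addrA subrK; congr (1 - _ ^+ _); lia.
rewrite mulrDr {2}Eg' -addSnnS Eg !qfactS; ring.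
Qed.

Hypothesis Q_free : forall k, 1 - Q ^+ k.+1 != 0.

Lemma qfact_neq0 k : qfact k != 0.
Proof. by apply/prodf_neq0 => i _. Qed.

(** Odd and even exponents are separated, and each even factor splits as a difference of squares. *)
Lemma qfact_double k :
  qfact (k + k) = \prod_(i < k) (1 - Q ^+ (2 * i + 1)) * (qfact k * qfact_plus k).
Proof.
rewrite /qfact /qfact_plus -big_split -big_split /=.
elim: k => [|k IH]; first by rewrite addn0 !big_ord0.
rewrite addSn addnS !big_ord_recr /= IH -!mulrA; congr (_ * _).
have -> : (2 * k + 1 = (k + k).+1)%N by lia.
have -> : (k + k).+2 = (k.+1 + k.+1)%N by lia.
by congr (_ * _); rewrite exprD; ring.
Qed.

(** The quotient of [(Q;Q^2)_k] by [(Q^2;Q^2)_k] is the Gauss binomial of [2k] over [k] divided by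
    the square of [(-Q;Q)_k], a form that can be specialized at roots of unity. *)
Lemma wpcoef_gauss k g : qfact (k + k) = g * (qfact k * qfact k) ->
  wpcoef a Q k = wpcoef_outer k * (g / qfact_plus k ^+ 2) ^+ 2.
Proof.
have plus0 : qfact_plus k != 0.
  by apply: contraNneq (qfact_neq0 (k + k)) => E; rewrite qfact_double E !mulr0.
have f0 := qfact_neq0 k.
have even_prod : \prod_(i < k) (1 - Q ^+ (2 * i + 2)) = qfact k * qfact_plus k.
  rewrite /qfact /qfact_plus -big_split; apply: eq_bigr => i _ /=.
  have -> : (2 * i + 2 = i.+1 + i.+1)%N by lia.
  by rewrite exprD; ring.
move=> Eg.
have -> : g / qfact_plus k ^+ 2 =
     \prod_(i < k) (1 - Q ^+ (2 * i + 1)) / \prod_(i < k) (1 - Q ^+ (2 * i + 2)).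
  have := qfact_double k; rewrite even_prod Eg; set P := \prod_(i < k) _ => E.
  have -> : P = g * (qfact k * qfact k) / (qfact k * qfact_plus k).
    by rewrite E mulfK // mulf_neq0.
  by field; rewrite plus0.
rewrite /wpcoef /wpcoef_outer -prodfV -big_split -prodrXl -big_split.
apply: eq_bigr => i _ /=.
by rewrite expr_div_n mulf_div.
Qed.

End GaussBinomial.

(** * Specialization at a root of unity, block by block *)

Section AtRootOfUnity.
Variables (A : idomainType) (L : fieldType) (phi : {rmorphism A -> L}).
Variables (a Q : {fraction A}) (al w : L) (h : nat).
Local Notation e := (h.*2.+1).
Local Notation "x ~> v" := (specializes phi x v) (at level 70).
Hypotheses (ha : a ~> al) (hQ : Q ~> w) (w_prim : e.-primitive_root w).
Hypothesis Q_free : forall k, 1 - Q ^+ k.+1 != 0.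
Hypotheses (al0 : al != 0) (two : (2 : L) != 0).
Hypothesis haw : forall i, 1 - al * w ^+ i != 0.
Hypothesis hwa : forall i, 1 - w ^+ i / al != 0.

(* The quotient is the Gaussian binomial, a polynomial in [Q] by Pascal's rule. *)
Lemma gauss_binomial m k :
  exists g v, g ~> v /\ qfact Q (m + k) = g * (qfact Q m * qfact Q k).
Proof.
have qfact0 : qfact Q 0 = 1 by rewrite /qfact big_ord0.
move: {2}(m + k)%N (leqnn (m + k)) => n; elim: n m k => [|n IH] m k.
  rewrite leqn0 addn_eq0 => /andP[/eqP-> /eqP->].
  by exists 1, 1; split; [exact: specializes1|rewrite qfact0 !mul1r].
case: m => [|m] H.
  by exists 1, 1; split; [exact: specializes1|rewrite qfact0 !mul1r].
case: k H => [|k] H.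
  by exists 1, 1; split; [exact: specializes1|rewrite qfact0 mulr1 mul1r addn0].
have [|g [v [hg Eg]]] := IH m.+1 k; first by lia.
have [|g' [v' [hg' Eg']]] := IH m k.+1; first by lia.
exists (g + Q ^+ k.+1 * g'), (v + w ^+ k.+1 * v'); split; last exact: qfact_pascal.
by apply: specializesD => //; apply: specializesM => //; apply: specializesX.
Qed.

Lemma specializes_qfact_plus k : qfact_plus Q k ~> qfact_plus w k.
Proof.
apply: (specializes_prod (f := fun i => 1 + Q ^+ i.+1) (g := fun i => 1 + w ^+ i.+1)).
by move=> i _; apply: specializesD; [exact: specializes1|exact: specializesX].
Qed.

(* [w] has odd order, hence [-1] is not a power of it. *)
Lemma qfact_plus_neq0 k : qfact_plus w k != 0.
Proof.
apply/prodf_neq0 => i _; apply: contraNneq two => /eqP.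
rewrite addrC addr_eq0 => /eqP E.
have : (w ^+ i.+1) ^+ e = 1.
  by rewrite -exprM mulnC exprM (prim_expr_order w_prim) expr1n.
rewrite E -signr_odd /= odd_double /= expr1 => E1.
by rewrite mulr2n -{1}E1 addNr.
Qed.

Lemma specializes_wpcoef_outer k : wpcoef_outer a Q k ~> wpcoef_outer al w k.
Proof.
apply: (specializes_prod
  (f := fun i => (1 - a * Q ^+ (2 * i + 1)) * (1 - Q ^+ (2 * i + 1) / a)
    / ((1 - a * Q ^+ (2 * i + 2)) * (1 - Q ^+ (2 * i + 2) / a)))
  (g := fun i => (1 - al * w ^+ (2 * i + 1)) * (1 - w ^+ (2 * i + 1) / al)
    / ((1 - al * w ^+ (2 * i + 2)) * (1 - w ^+ (2 * i + 2) / al)))) => i _.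
have h1 := specializes1 phi.
have hX j : Q ^+ j ~> w ^+ j by apply: specializesX.
have hY j : 1 - a * Q ^+ j ~> 1 - al * w ^+ j.
  by apply: specializesB => //; apply: specializesM.
have hZ j : 1 - Q ^+ j / a ~> 1 - w ^+ j / al.
  by apply: specializesB => //; apply: specializes_div.
by apply: specializes_div; [rewrite mulf_neq0|apply: specializesM|apply: specializesM].
Qed.

(** This covers [k >= e] as well, where single ratios have vanishing denominators: the Gauss
    binomial form has none. *)
Lemma wpcoef_regular k : exists v, wpcoef a Q k ~> v.
Proof.
have [g [v [hg Eg]]] := gauss_binomial k k.
exists (wpcoef_outer al w k * (v / qfact_plus w k ^+ 2) ^+ 2).
rewrite (wpcoef_gauss a Q_free Eg).
apply: specializesM; first exact: specializes_wpcoef_outer.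
apply: specializesX; apply: specializes_div => //.
  by rewrite expf_neq0 // qfact_plus_neq0.
by apply: specializesX; apply: specializes_qfact_plus.
Qed.

Lemma expw_block l i j : w ^+ (l * e + i + j) = w ^+ (i + j).
Proof. by rewrite -addnA exprD mulnC exprM (prim_expr_order w_prim) expr1n mul1r. Qed.

(** The constant [c] is the value of the coefficient of index [l * e]. The next ratios depend on the
    index modulo [e] only, and their denominators do not vanish before the block ends. *)
Lemma specializes_wpcoef_block l :
  exists c, forall s, (s < e)%N -> wpcoef a Q (l * e + s) ~> c * wpcoef al w s.
Proof.
have [c hc] := wpcoef_regular (l * e); exists c => s se.
rewrite {1}/wpcoef big_split_ord; apply: specializesM => //=.
apply: (specializes_prod (f := fun i => wpratio a Q (l * e + i)) (g := wpratio al w)).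
move=> i si.
have E j : w ^+ (2 * (l * e + i) + j) = w ^+ (2 * i + j).
  by rewrite mulnDr mulnA expw_block.
rewrite -[wpratio al w i]/(wpfactor al _ / wpfactor al _) -!E.
apply: specializes_wpratio => //.
by rewrite E; apply: (wpfactor_even_neq0 w_prim) => //; apply: leq_ltn_trans se.
Qed.

Hypothesis h_gt0 : (0 < h)%N.

Lemma prim_neq1 : 1 - w != 0.
Proof.
rewrite subr_eq0 eq_sym -[w]expr1 -(prim_order_dvd w_prim) dvdn1.
by rewrite eqSS double_eq0 -lt0n.
Qed.

Lemma wpsum_splitD (F : fieldType) (b u : F) m n : wpsum b u (m + n) =
  wpsum b u m + \sum_(i < n) (1 - u ^+ (4 * (m + i) + 1)) / (1 - u) * wpcoef b u (m + i).
Proof. by rewrite /wpsum big_split_ord. Qed.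

(** The factor [1 - w ^+ (4 * k + 1)] is also periodic in [k], so the added terms specialize to [c]
    times those of [wpsum al w s]. *)
Lemma specializes_wpsum_block l s : (s <= e)%N -> wpsum al w s = 0 ->
  wpsum a Q (l * e) ~> 0 -> wpsum a Q (l * e + s) ~> 0.
Proof.
move=> se E0 hl; rewrite wpsum_splitD -[X in _ ~> X]addr0; apply: specializesD => //.
have [c hc] := specializes_wpcoef_block l.
rewrite -[X in _ ~> X](mulr0 c) -E0 /wpsum mulr_sumr.
have h1 := specializes1 phi.
apply: (specializes_sum
  (f := fun i => (1 - Q ^+ (4 * (l * e + i) + 1)) / (1 - Q) * wpcoef a Q (l * e + i))
  (g := fun i => c * ((1 - w ^+ (4 * i + 1)) / (1 - w) * wpcoef al w i))) => i si.
rewrite mulrCA; apply: specializesM; last by apply: hc; apply: leq_trans se.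
apply: specializes_div; [exact: prim_neq1| |exact: specializesB].
apply: specializesB => //.
have -> : w ^+ (4 * i + 1) = w ^+ (4 * (l * e + i) + 1).
  by rewrite mulnDr mulnA expw_block.
exact: specializesX.
Qed.

(** The two lengths serve [d = 1], whole blocks of [e] terms, and [d = 2], whole blocks followed by
    the first [h.+1] terms of the next. *)
Lemma specializes_wpsum_prim l :
  wpsum a Q (l * e) ~> 0 /\ wpsum a Q (l * e + h.+1) ~> 0.
Proof.
have half : wpsum al w h.+1 = 0 by apply: (wpsum_half w_prim).
have full : wpsum al w e = 0.
  have -> : (e = h.+1 + h)%N by lia.
  rewrite wpsum_splitD half add0r big1 // => i _.
  by rewrite (wpcoef_tail_eq0 w_prim) ?mulr0 // addSn ltnS leq_addr.
have zero : wpsum a Q (l * e) ~> 0.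
  elim: l => [|l IH]; first by rewrite /wpsum big_ord0; apply: specializes0.
  by rewrite mulSn addnC; apply: specializes_wpsum_block.
split=> //; apply: specializes_wpsum_block => //.
by rewrite ltnS -addnn leq_addr.
Qed.

End AtRootOfUnity.

(** * Passing from the prime factors to their product *)

Section LocalGlobal.
Variables (L : fieldType) (I : eqType) (P : I -> Pqa) (phi : I -> {rmorphism Pqa -> L}).
Hypothesis P_ker : forall i (N : Pqa), phi i N = 0 -> pdivides (P i) N.
Hypothesis P_neq0 : forall i, P i != 0.

Let separated (s : seq I) := {in s &, forall i j, i != j -> phi i (P j) != 0}.

Lemma separated_cons i s : uniq (i :: s) -> separated (i :: s) ->
  [/\ separated s, {in s, forall j, phi j (P i) != 0}
    & {in s, forall j, phi i (P j) != 0}].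
Proof.
move=> /andP[i_s _] H; split=> [j k js ks|j js|j js].
- by apply: H; rewrite inE ?js ?ks orbT.
- apply: H; rewrite ?inE ?js ?eqxx ?orbT //.
  by apply: contraNneq i_s => <-.
apply: H; rewrite ?inE ?js ?eqxx ?orbT //.
by apply: contraNneq i_s => ->.
Qed.

Lemma phi_prod_neq0 i s : {in s, forall j, phi i (P j) != 0} ->
  phi i (\prod_(j <- s) P j) != 0.
Proof.
elim: s => [|j s IH] H; first by rewrite big_nil rmorph1 oner_neq0.
rewrite big_cons rmorphM mulf_neq0 ?H ?mem_head // IH // => k ks.
by rewrite H // inE ks orbT.
Qed.

(** After [P i] is divided out, the cofactor still vanishes at every other place, because [P i] does
    not. *)
Lemma prod_dvd s (N : Pqa) : uniq s -> separated s ->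
  {in s, forall i, phi i N = 0} -> pdivides (\prod_(i <- s) P i) N.
Proof.
elim: s N => [|i s IH] N us sep H; first by exists N; rewrite big_nil mul1r.
have [seps hi _] := separated_cons us sep; have /andP[_ us'] := us.
have [C NC] := P_ker (H i (mem_head _ _)).
have [|C' CC'] := IH C us' seps.
  move=> j js; have := H j; rewrite inE js orbT NC rmorphM => /(_ isT) /eqP.
  by rewrite mulf_eq0 (negPf (hi j js)) => /eqP.
by exists C'; rewrite big_cons NC CC' mulrA.
Qed.

(** A common divisor [c] is nonzero at each place, since [D] is. So each [P i] divides the cofactor
    of [c] in the product and cancels; in the end [c] divides 1. *)
Lemma rel_prime_prod s (D : Pqa) : uniq s -> separated s ->
  {in s, forall i, phi i (P i) = 0} ->
  {in s, forall i, phi i D != 0} -> rel_prime D (\prod_(i <- s) P i).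
Proof.
move=> + + + + c [u Du]; elim: s => [|i s IH] us sep z nz.
  by case=> v; rewrite big_nil => E; apply/unitrPr; exists v.
have [seps _ _] := separated_cons us sep; have /andP[_ us'] := us.
case=> v; rewrite big_cons => E.
have ci : phi i c != 0.
  by have := nz i (mem_head _ _); rewrite Du rmorphM mulf_eq0 negb_or => /andP[].
have [v' Ev] : pdivides (P i) v.
  apply: P_ker; apply: (mulfI ci); rewrite mulr0 -rmorphM -E rmorphM.
  by rewrite z ?mem_head // mul0r.
apply: IH us' seps _ _ _ => [j js|j js|]; [by apply: z; rewrite inE js orbT|
  by apply: nz; rewrite inE js orbT|].
by exists v'; apply: (mulfI (P_neq0 i)); rewrite E Ev mulrCA.
Qed.

(* Prime avoidance: from representations [N_i / D_i] adapted to each place, the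
   denominator [\sum_i D_i * \prod_(j != i) P_j] is adapted to all of them. *)
Lemma common_denominator s (x : Kqa) : uniq s -> separated s ->
  {in s, forall i, phi i (P i) = 0} ->
  {in s, forall i, specializes (phi i) x 0} ->
  exists N D : Pqa, toK N = x * toK D /\
    {in s, forall i, phi i N = 0 /\ phi i D != 0}.
Proof.
elim: s => [|i s IH] us sep z H.
  by exists 0, 0; split=> //; rewrite /toK !rmorph0 mulr0.
have [seps hi hi'] := separated_cons us sep; have /andP[_ us'] := us.
have [|j js|N [D [ND HND]]] := IH us' seps.
- by move=> j js; apply: z; rewrite inE js orbT.
- by apply: H; rewrite inE js orbT.
have [N0 [D0 [d0 E0 /esym/eqP]]] := H i (mem_head _ _).
rewrite mulf_eq0 invr_eq0 (negPf d0) orbF => /eqP n0.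
set R := \prod_(j <- s) P j.
have Ri : phi i R != 0 by apply: phi_prod_neq0.
have Rj j : j \in s -> phi j R = 0.
  move=> js; rewrite /R (big_rem j) //= rmorphM z ?mul0r //.
  by rewrite inE js orbT.
exists (N * P i + N0 * R), (D * P i + D0 * R); split.
  have EN0 : toK N0 = x * toK D0.
    by rewrite E0 divfK // tofrac_eq0; apply: phi_neq0 d0.
  by rewrite /toK in ND EN0 *; rewrite !tofracD !tofracM ND EN0 mulrDr !mulrA.
move=> j; rewrite inE => /orP[/eqP->|js]; rewrite !rmorphD !rmorphM.
  by rewrite z ?mem_head // n0 !mulr0 mul0r !add0r mulf_neq0.
by have [-> d] := HND j js; rewrite Rj // mul0r !mulr0 !addr0 mulf_neq0 // hi.
Qed.

Lemma congr_mod_prod s (x y : Kqa) i0 : i0 \in s -> uniq s -> separated s ->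
  {in s, forall i, phi i (P i) = 0} ->
  {in s, forall i, specializes (phi i) (x - y) 0} ->
  congr_mod x y (\prod_(i <- s) P i).
Proof.
move=> s0 us sep z H; have [N [D [ND HND]]] := common_denominator us sep z H.
(* The member [i0] rules out the empty list, for which the common denominator is 0. *)
have D0 : D != 0 by have [_ /phi_neq0] := HND _ s0.
exists N, D; split=> //; split.
  by rewrite ND mulfK // tofrac_eq0.
split; first by apply: prod_dvd => // i /HND[].
by apply: rel_prime_prod => // i /HND[].
Qed.

End LocalGlobal.

(** * The prime factors of the modulus *)

(** One target field for all places: the indeterminate [t] is the value of [a] when [q] goes to a
    root of unity, and the value of [q] when [a] goes to a power of [q]. *)
Definition Lt := {fraction {poly algC}}.
Definition constL (c : algC) : Lt := FracField.tofrac c%:P.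
Definition tL : Lt := FracField.tofrac ('X : {poly algC}).

Definition ratL : {rmorphism rat -> Lt} :=
  (@FracField.tofrac {poly algC}) \o (polyC \o (ratr : rat -> algC)).

Definition specialize (al be : Lt) : {rmorphism Pqa -> Lt} :=
  horner_eval be \o map_poly (horner_eval al \o map_poly ratL).

Definition liftq (g : {poly rat}) : Pqa := map_poly polyC g.

Lemma specialize_q al be : specialize al be qP = be.
Proof. by rewrite /= map_polyX /horner_eval hornerX. Qed.

Lemma specialize_a al be : specialize al be aP = al.
Proof. by rewrite /= map_polyC /= map_polyX /horner_eval hornerC hornerX. Qed.

Lemma specialize_liftq al be g : specialize al be (liftq g) = (map_poly ratL g).[be].
Proof.
rewrite /= /liftq -map_poly_comp; congr (_.[_]); apply: eq_map_poly => c /=.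
by rewrite map_polyC /horner_eval hornerC.
Qed.

Lemma ratL_horner g (p : {poly algC}) :
  (map_poly ratL g).[FracField.tofrac p] = FracField.tofrac ((map_poly ratr g : {poly algC}) \Po p).
Proof.
by rewrite /comp_poly -(horner_map (@FracField.tofrac _)) -!map_poly_comp.
Qed.

Lemma specialize_liftq_t al g : specialize al tL (liftq g) = FracField.tofrac (map_poly ratr g).
Proof. by rewrite specialize_liftq ratL_horner comp_polyXr. Qed.

Lemma specialize_liftq_const al c g :
  specialize al (constL c) (liftq g) = constL (map_poly ratr g).[c].
Proof.
rewrite specialize_liftq ratL_horner.
by congr FracField.tofrac; rewrite comp_polyCr.
Qed.

Lemma tL_neq0 : tL != 0.
Proof. by rewrite tofrac_eq0 polyX_eq0. Qed.

Lemma tL_free k : (0 < k)%N -> tL ^+ k != 1.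
Proof.
move=> k0; rewrite -subr_eq0 /tL -tofracXn -tofrac1 -tofracB tofrac_eq0.
by rewrite monic_neq0 // monicXnsubC.
Qed.

Lemma constLX c i : constL c ^+ i = constL (c ^+ i).
Proof. by rewrite /constL -tofracXn polyC_exp. Qed.

Lemma one_sub_t_const c : 1 - tL * constL c != 0.
Proof.
rewrite /tL /constL -tofracM -tofrac1 -tofracB tofrac_eq0; apply/eqP => /polyP/(_ 0%N).
by rewrite coefB coef1 coefXM coef0 /= subr0 => /eqP; rewrite oner_eq0.
Qed.

Lemma t_sub_const c : tL - constL c != 0.
Proof. by rewrite /tL /constL -tofracB tofrac_eq0 polyXsubC_eq0. Qed.

Lemma one_sub_const_div_t c : 1 - constL c / tL != 0.
Proof.
rewrite -(divff tL_neq0) -mulrBl mulf_neq0 ?invr_eq0 ?tL_neq0 //.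
exact: t_sub_const.
Qed.

Lemma two_neq0_Lt : (2 : Lt) != 0.
Proof.
rewrite -(rmorph_nat (@FracField.tofrac _)) tofrac_eq0 -polyC_natr polyC_eq0.
by rewrite Num.Theory.pnatr_eq0.
Qed.

Lemma pdividesD (M x y : Pqa) : pdivides M x -> pdivides M y -> pdivides M (x + y).
Proof. by move=> [u ->] [v ->]; exists (u + v); rewrite mulrDr. Qed.

Lemma pdividesMl (M x y : Pqa) : pdivides M x -> pdivides M (y * x).
Proof. by move=> [u ->]; exists (y * u); rewrite mulrCA. Qed.

(* Hypothesis: modulo [M], the variable [a] is the fraction [g0 / u] of Q(q). *)
Lemma eliminate_a (M : Pqa) (u g0 : {poly rat}) :
  pdivides M (liftq u * aP - liftq g0) ->
  forall N, exists k g, pdivides M (liftq u ^+ k * N - liftq g).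
Proof.
move=> Ha.
pose good N := exists k g, pdivides M (liftq u ^+ k * N - liftq g).
have goodq g : good (liftq g).
  by exists 0%N, g; exists 0; rewrite expr0 mul1r subrr mulr0.
have goodD x y : good x -> good y -> good (x + y).
  move=> [k [g hx]] [l [g' hy]]; exists (k + l)%N, (u ^+ l * g + u ^+ k * g').
  have -> : liftq u ^+ (k + l) * (x + y) - liftq (u ^+ l * g + u ^+ k * g') =
    liftq u ^+ l * (liftq u ^+ k * x - liftq g)
    + liftq u ^+ k * (liftq u ^+ l * y - liftq g').
    by rewrite /liftq rmorphD !rmorphM !rmorphXn /= exprD; ring.
  by apply: pdividesD; apply: pdividesMl.
have goodM x y : good x -> good y -> good (x * y).
  move=> [k [g hx]] [l [g' hy]]; exists (k + l)%N, (g * g').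
  have -> : liftq u ^+ (k + l) * (x * y) - liftq (g * g') =
    (liftq u ^+ l * y) * (liftq u ^+ k * x - liftq g)
    + liftq g * (liftq u ^+ l * y - liftq g').
    by rewrite /liftq !rmorphM /= exprD; ring.
  by apply: pdividesD; apply: pdividesMl.
have gooda : good aP by exists 1%N, g0; rewrite expr1.
have goodC (c : {poly rat}) : good c%:P.
  elim/poly_ind: c => [|c r IH].
    by have := goodq 0; rewrite /liftq rmorph0.
  rewrite rmorphD rmorphM /=; apply: goodD; first exact: goodM.
  by have := goodq r%:P; rewrite /liftq map_polyC.
elim/poly_ind => [|N c IH]; first exact: (goodC 0).
apply: goodD => //; apply: goodM => //.
by have := goodq 'X; rewrite /liftq map_polyX.
Qed.

(** Modulo [M], a power of [u] times [N] is a polynomial [g] in [q] alone. It vanishes at the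
    transcendental [t], so [g = 0], and the powers of [u] cancel. *)
Lemma eliminate_a_ker (M : Pqa) (u g0 : {poly rat}) al :
  pdivides M (liftq u * aP - liftq g0) ->
  (forall N, pdivides M (liftq u * N) -> pdivides M N) ->
  specialize al tL M = 0 ->
  forall N, specialize al tL N = 0 -> pdivides M N.
Proof.
move=> Ha Hu M0 N N0; have [k [g [C HC]]] := eliminate_a Ha N.
have g0' : g = 0.
  have /eqP := congr1 (specialize al tL) HC.
  rewrite rmorphB !rmorphM M0 N0 mulr0 mul0r sub0r oppr_eq0 specialize_liftq_t.
  by rewrite tofrac_eq0 map_poly_eq0 => /eqP.
have {HC} : pdivides M (liftq u ^+ k * N).
  by exists C; rewrite -HC g0' /liftq rmorph0 subr0.
elim: k => [|k IH]; first by rewrite expr0 mul1r.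
by rewrite exprS -mulrA => /Hu.
Qed.

Lemma liftqXn m : liftq 'X^m = qP ^+ m.
Proof. by rewrite /liftq rmorphXn /= map_polyX. Qed.

Lemma ker_one_sub_aq m N : (0 < m)%N ->
  specialize (tL ^- m) tL N = 0 -> pdivides (1 - aP * qP ^+ m) N.
Proof.
move=> m0; apply: (@eliminate_a_ker _ 'X^m 1).
- by exists (-1); rewrite liftqXn /liftq rmorph1; ring.
(* Modulo [1 - a q^m] the power [q^m] is invertible with inverse [a], which gives the cofactor. *)
- move=> {}N [C HC]; exists (N + aP * C); rewrite mulrDr [_ * (aP * C)]mulrCA -HC liftqXn.
  by ring.
rewrite rmorphB rmorph1 rmorphM rmorphXn specialize_a specialize_q.
by rewrite mulVf ?subrr // expf_neq0 // tL_neq0.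
Qed.

Lemma ker_a_sub_q m N :
  specialize (tL ^+ m) tL N = 0 -> pdivides (aP - qP ^+ m) N.
Proof.
apply: (@eliminate_a_ker _ 1 'X^m).
- by exists 1; rewrite mulr1 liftqXn /liftq rmorph1 mul1r.
- by move=> {}N; rewrite /liftq rmorph1 mul1r.
by rewrite rmorphB rmorphXn specialize_a specialize_q subrr.
Qed.

Definition cycloP e : Pqa := liftq (map_poly intr 'Phi_e).

(** ['Phi_e] is the minimal polynomial of [z] over the rationals. *)
Lemma cyclo_minimal e z (r : {poly rat}) : e.-primitive_root z ->
  root (map_poly ratr r : {poly algC}) z ->
  (size r < size (map_poly intr 'Phi_e : {poly rat}))%N -> r = 0.
Proof.
move=> ze rz sz; apply/eqP; apply: contraTT sz => r0.
have [p [Ep mp] hp] := minCpolyP z.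
have -> : size (map_poly intr 'Phi_e : {poly rat}) = size p.
  rewrite -(size_map_poly (ratr : rat -> algC) p) -Ep (minCpoly_cyclotomic ze).
  rewrite -(Cintr_Cyclotomic ze) !size_map_poly_id0 //.
  - by rewrite (monicP (Cyclotomic_monic e)) rmorph1 oner_neq0.
  by rewrite (monicP (Cyclotomic_monic e)) rmorph1 oner_neq0.
by rewrite -leqNgt dvdp_leq // -hp.
Qed.

Lemma cycloP_monic e : cycloP e \is monic.
Proof. by rewrite /cycloP /liftq !monic_map ?Cyclotomic_monic. Qed.

Definition zeta e : algC :=
  if e is e'.+1 then sval (C_prim_root_exists (ltn0Sn e')) else 1.

Lemma zeta_prim e : (0 < e)%N -> e.-primitive_root (zeta e).
Proof. by case: e => // e _; rewrite /zeta; case: C_prim_root_exists. Qed.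

Lemma root_cycloP e z : (0 < e)%N ->
  (specialize tL (constL z) (cycloP e) == 0) = e.-primitive_root z.
Proof.
move=> e0; rewrite specialize_liftq_const -map_poly_comp.
have -> : map_poly (ratr \o intr) 'Phi_e = map_poly intr 'Phi_e :> {poly algC}.
  by apply: eq_map_poly => c /=; rewrite ratr_int.
rewrite (Cintr_Cyclotomic (zeta_prim e0)) /constL tofrac_eq0 polyC_eq0.
by rewrite -rootE root_cyclotomic ?zeta_prim.
Qed.

(** Division by the monic [cycloP e] leaves a remainder of small degree in [q] that vanishes at
    [q = z]. As [a] goes to an indeterminate, the coefficient of each power of [a] vanishes at [z],
    hence is 0 by minimality. *)
Lemma ker_cyclo e z N : e.-primitive_root z ->
  specialize tL (constL z) N = 0 -> pdivides (cycloP e) N.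
Proof.
move=> ze N0.
have E := Pdiv.RingMonic.rdivp_eq (cycloP_monic e) N.
set R := Pdiv.Ring.rmodp _ _ in E.
have sR : (size R < size (cycloP e))%N.
  by apply: Pdiv.Ring.ltn_rmodpN0; apply: monic_neq0; apply: cycloP_monic.
have P0 : specialize tL (constL z) (cycloP e) = 0.
  by apply/eqP; rewrite root_cycloP ?(prim_order_gt0 ze).
suff R0 : R = 0 by exists (Pdiv.Ring.rdivp N (cycloP e)); rewrite {1}E R0 addr0 mulrC.
have : specialize tL (constL z) R = 0.
  by have := congr1 (specialize tL (constL z)) E; rewrite rmorphD rmorphM P0 mulr0 add0r N0.
have -> : specialize tL (constL z) R =
  FracField.tofrac (\sum_(i < size R) map_poly ratr R`_i * (z ^+ i)%:P).
  rewrite -[LHS]/((map_poly (horner_eval tL \o map_poly ratL) R).[constL z]).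
  rewrite (@horner_coef_wide _ (size R)); last exact: size_poly.
  rewrite rmorph_sum /=; apply: eq_bigr => i _.
  rewrite coef_map [RHS]rmorphM /= constLX; congr (_ * _).
  by rewrite /horner_eval ratL_horner comp_polyXr.
move/eqP; rewrite tofrac_eq0 => /eqP Q0.
have key j : \poly_(i < size R) R`_i`_j = 0.
  apply: (cyclo_minimal ze); last first.
    apply: leq_ltn_trans (size_poly _ _) _.
    by move: sR; rewrite /cycloP /liftq size_map_polyC.
  apply/rootP; move/polyP/(_ j): Q0; rewrite coef0 coef_sum => Ej; rewrite -[RHS]Ej.
  rewrite (@horner_coef_wide _ (size R)); last first.
    by apply: leq_trans (size_poly _ _) (size_poly _ _).
  by apply: eq_bigr => i _; rewrite coefMC !coef_map coef_poly ltn_ord.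
apply/polyP => i; rewrite coef0; apply/polyP => j; rewrite coef0.
have := congr1 (fun p : {poly rat} => p`_i) (key j); rewrite coef_poly coef0.
by case: ltnP => // /(nth_default 0) ->; rewrite coef0.
Qed.

(** * The sums of the statement in terms of [wpsum] *)

Lemma geometric_quotient (F : fieldType) (Q : F) m : 1 - Q != 0 ->
  \sum_(i < m) Q ^+ i = (1 - Q ^+ m) / (1 - Q).
Proof.
move=> Q1; apply: (canRL (mulfK Q1)); rewrite mulrC.
by rewrite -[RHS]opprB subrX1 -mulNr opprB.
Qed.

Lemma wpcoef_prods (F : fieldType) (a Q : F) k :
  wpcoef a Q k =
  (\prod_(i < k) (1 - a * Q * (Q ^+ 2) ^+ i) * \prod_(i < k) (1 - Q / a * (Q ^+ 2) ^+ i)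
    * (\prod_(i < k) (1 - Q * (Q ^+ 2) ^+ i)) ^+ 2)
  / (\prod_(i < k) (1 - a * Q ^+ 2 * (Q ^+ 2) ^+ i)
     * \prod_(i < k) (1 - Q ^+ 2 / a * (Q ^+ 2) ^+ i)
     * (\prod_(i < k) (1 - Q ^+ 2 * (Q ^+ 2) ^+ i)) ^+ 2).
Proof.
rewrite -!prodrXl -!big_split -prodfV -big_split; apply: eq_bigr => i _ /=.
by rewrite wpratioE ![_ / a * _]mulrAC.
Qed.

Lemma summandE Q k : summand Q k = qint Q (4 * k + 1) * wpcoef aK Q k.
Proof. by rewrite wpcoef_prods mulrA. Qed.

Lemma qsumE Q N : 1 - Q != 0 -> qsum Q N = wpsum aK Q N.+1.
Proof.
move=> Q1; apply: eq_bigr => k _.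
by rewrite summandE /qint geometric_quotient.
Qed.

Lemma qK_free k : (0 < k)%N -> 1 - qK ^+ k != 0.
Proof.
move=> k0; rewrite /qK /toK -tofracXn -tofrac1 -tofracB tofrac_eq0.
by rewrite -opprB oppr_eq0 monic_neq0 // monicXnsubC.
Qed.

Lemma qKX_free n k : (0 < n)%N -> 1 - (qK ^+ n) ^+ k.+1 != 0.
Proof. by move=> n0; rewrite -exprM qK_free // muln_gt0 n0. Qed.

Lemma specializes_aK al be : specializes (specialize al be) aK al.
Proof. by rewrite -[X in specializes _ _ X](specialize_a al be); apply: specializes_tofrac. Qed.

Lemma specializes_qK al be : specializes (specialize al be) qK be.
Proof. by rewrite -[X in specializes _ _ X](specialize_q al be); apply: specializes_tofrac. Qed.

Lemma specializes_qint al be m :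
  specializes (specialize al be) (qint qK m) (\sum_(i < m) be ^+ i).
Proof.
apply: (specializes_sum (f := fun i => qK ^+ i) (g := fun i => be ^+ i)) => i _.
exact: specializesX (specializes_qK _ _).
Qed.

(** * Places where [a] is a power of [q] *)

Section NotRootOfUnity.
Variables (F : fieldType) (t : F).
Hypotheses (t0 : t != 0) (free : forall k, (0 < k)%N -> t ^+ k != 1).

Lemma expf_sub_neq0 u v : u != v -> t ^+ u - t ^+ v != 0.
Proof.
wlog uv : u v / (u < v)%N.
  move=> H; rewrite neq_ltn => /orP[uv|vu]; first by apply: H; rewrite ?ltn_eqF.
  by rewrite -opprB oppr_eq0; apply: H; rewrite ?ltn_eqF.
move=> _; rewrite -(subnKC (ltnW uv)) exprD -{1}[t ^+ u]mulr1 -mulrBr.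
apply: mulf_neq0; first exact: expf_neq0.
by rewrite subr_eq0 eq_sym free // subn_gt0.
Qed.

Lemma one_sub_expf_neq0 u : (0 < u)%N -> 1 - t ^+ u != 0.
Proof. by move=> u0; rewrite subr_eq0 eq_sym free. Qed.

(** Odd and even exponents never meet, so the denominators survive although [a] is a power of
    [t]. *)
Lemma wpfactor_expf_neq0 u v : odd u -> ~~ odd v -> (0 < v)%N ->
  wpfactor (t ^+ u) (t ^+ v) != 0.
Proof.
move=> ou ev v0; have uv : u != v by apply: contraNneq ev => <-.
have tu := expf_neq0 u t0.
apply: wpfactor_neq0.
- by rewrite -exprD one_sub_expf_neq0 // addn_gt0 v0 orbT.
- rewrite -(divff tu) -mulrBl; apply: mulf_neq0; first exact: expf_sub_neq0.
  by rewrite invr_eq0.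
exact: one_sub_expf_neq0.
Qed.

End NotRootOfUnity.

(** The root in [a] of [1 - a t^m] for [b = true], and of [a - t^m] for [b = false]. *)
Definition a_place (F : fieldType) (t : F) (b : bool) m : F := if b then t ^- m else t ^+ m.

Lemma a_place_neq0 (F : fieldType) (t : F) b m : t != 0 -> a_place t b m != 0.
Proof. by move=> t0; case: b; rewrite ?invr_eq0 expf_neq0. Qed.

Lemma wpsum_a_place (F : fieldType) (t : F) n b j N :
  t != 0 -> (forall k, (0 < k)%N -> t ^+ k != 1) -> (0 < n)%N -> (j < N)%N ->
  wpsum (a_place t b (n * (2 * j + 1))) (t ^+ n) N
  = t ^- (n * j) * (1 - t ^+ (n * (2 * j + 1))) / (1 - t ^+ n).
Proof.
move=> t0 free n0 jN.
have -> : wpsum (a_place t b (n * (2 * j + 1))) (t ^+ n) N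
  = wpsum ((t ^+ n) ^+ (2 * j + 1)) (t ^+ n) N.
  by case: b; rewrite /a_place exprM // wpsumV.
rewrite wpsum_terminating ?expf_neq0 -?exprM // => k k0.
by rewrite -exprM free // muln_gt0 n0.
Qed.

Lemma wpfactor_a_place (F : fieldType) (t : F) b u v :
  t != 0 -> (forall k, (0 < k)%N -> t ^+ k != 1) -> odd u -> ~~ odd v -> (0 < v)%N ->
  wpfactor (a_place t b u) (t ^+ v) != 0.
Proof.
move=> t0 free ou ev v0.
by case: b; rewrite /a_place ?wpfactorV wpfactor_expf_neq0.
Qed.

Lemma specializes_qsum_a b n j N : odd n -> (j <= N)%N ->
  specializes (specialize (a_place tL b (n * (2 * j + 1))) tL) (qsum (qK ^+ n) N)
    (tL ^- (n * j) * (1 - tL ^+ (n * (2 * j + 1))) / (1 - tL ^+ n)).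
Proof.
move=> on jN; have n0 : (0 < n)%N by case: n on.
rewrite qsumE; last by rewrite -[qK ^+ n]expr1 qKX_free.
rewrite -(@wpsum_a_place _ tL n b j N.+1 tL_neq0 tL_free n0 jN).
apply: specializes_wpsum.
- exact: a_place_neq0 tL_neq0.
- exact: one_sub_expf_neq0 tL_free _ n0.
- move=> i; rewrite -exprM; apply: (wpfactor_a_place _ tL_neq0 tL_free).
  + by rewrite oddM on addn1 /= mul2n odd_double.
  + by rewrite oddM on addn2 /= mul2n odd_double.
  by rewrite muln_gt0 n0 addn2.
- exact: specializes_aK.
exact: specializesX (specializes_qK _ _).
Qed.

(** * Places where [q] is a root of unity *)

Section AtZeta.
Variables (z : algC) (n h : nat).
Hypotheses (n_gt0 : (0 < n)%N) (zn_prim : h.*2.+1.-primitive_root (z ^+ n)).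
Local Notation place := (specialize tL (constL z)).

Lemma constL_prim : h.*2.+1.-primitive_root (constL (z ^+ n)).
Proof.
have -> : constL (z ^+ n) = ((@FracField.tofrac _) \o polyC) (z ^+ n) by [].
by rewrite fmorph_primitive_root.
Qed.

Lemma specializes_qKX : specializes place (qK ^+ n) (constL (z ^+ n)).
Proof. by rewrite -constLX; apply: specializesX (specializes_qK _ _). Qed.

Lemma one_sub_t_constX i : 1 - tL * constL (z ^+ n) ^+ i != 0.
Proof. by rewrite constLX one_sub_t_const. Qed.

Lemma one_sub_constX_div_t i : 1 - constL (z ^+ n) ^+ i / tL != 0.
Proof. by rewrite constLX one_sub_const_div_t. Qed.

(** Meant for [h = 0], where [z ^+ n = 1] and only finiteness of the sum is wanted. The q-integers
    stay sums here, as [1 - z ^+ n] may vanish. *)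
Lemma qsum_regular N : exists v, specializes place (qsum (qK ^+ n) N) v.
Proof.
rewrite /qsum; elim: N.+1 => [|m [v IH]].
  by exists 0; rewrite big_ord0; apply: specializes0.
have [u hu] := wpcoef_regular (specializes_aK tL (constL z)) specializes_qKX constL_prim
  (fun k => qKX_free k n_gt0) tL_neq0 two_neq0_Lt one_sub_t_constX one_sub_constX_div_t m.
exists (v + (\sum_(i < 4 * m + 1) constL (z ^+ n) ^+ i) * u).
rewrite big_ord_recr; apply: specializesD => //.
rewrite summandE; apply: specializesM => //.
apply: (specializes_sum (f := fun i => (qK ^+ n) ^+ i) (g := fun i => constL (z ^+ n) ^+ i)).
by move=> i _; apply: specializesX specializes_qKX.
Qed.

Lemma specializes_qsum_zeta M d : (0 < h)%N -> odd M -> (h.*2.+1 %| M)%N ->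
  (d = 1 \/ d = 2)%N -> specializes place (qsum (qK ^+ n) ((M - 1) %/ d)) 0.
Proof.
move=> h0 oM /dvdnP[l El] hd.
rewrite qsumE; last by rewrite -[qK ^+ n]expr1 qKX_free.
have H := specializes_wpsum_prim (specializes_aK tL (constL z)) specializes_qKX constL_prim
  (fun k => qKX_free k n_gt0) tL_neq0 two_neq0_Lt one_sub_t_constX one_sub_constX_div_t h0.
case: hd => ->.
  have -> : ((M - 1) %/ 1).+1 = (l * h.*2.+1)%N by rewrite divn1 -El; lia.
  by have [] := H l.
have ol : odd l by move: oM; rewrite El oddM => /andP[].
(* For [l = 2x + 1] and [e = 2h + 1], half of [l e + 1] is [x e + h + 1]. *)
have -> : ((M - 1) %/ 2).+1 = (l./2 * h.*2.+1 + h.+1)%N.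
  have := odd_double_half l; rewrite ol add1n El; move: (l./2) => x <-.
  lia.
by have [] := H l./2.
Qed.

End AtZeta.

Lemma one_sub_a_place_neq0 (F : fieldType) (t : F) (b : bool) u v :
  t != 0 -> (forall k, (0 < k)%N -> t ^+ k != 1) -> (0 < v)%N -> (b -> u != v) ->
  1 - a_place t b u * t ^+ v != 0.
Proof.
move=> t0 free v0; have tu := expf_neq0 u t0; case: b => [/(_ isT) uv|_] /=.
  rewrite -[1](mulVf tu) -mulrBr; apply: mulf_neq0; first by rewrite invr_eq0.
  exact: expf_sub_neq0.
by rewrite -exprD one_sub_expf_neq0 // addn_gt0 v0 orbT.
Qed.

Lemma a_place_sub_neq0 (F : fieldType) (t : F) (b : bool) u v :
  t != 0 -> (forall k, (0 < k)%N -> t ^+ k != 1) -> (0 < v)%N -> (~~ b -> u != v) ->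
  a_place t b u - t ^+ v != 0.
Proof.
move=> t0 free v0; have tu := expf_neq0 u t0; case: b => [_|/(_ isT) uv] /=.
  rewrite -[_^-1]mulr1 -[t ^+ v](mulKf tu) -mulrBr; apply: mulf_neq0.
    by rewrite invr_eq0.
  by rewrite -exprD one_sub_expf_neq0 // addn_gt0 v0 orbT.
exact: expf_sub_neq0.
Qed.

Lemma prim_order_inj (R : nzRingType) (z : R) u v :
  u.-primitive_root z -> v.-primitive_root z -> u = v.
Proof.
move=> hu hv; apply/eqP; rewrite eqn_dvd (prim_order_dvd hu) (prim_order_dvd hv).
by rewrite !prim_expr_order // eqxx.
Qed.

(** The factor ['Phi_1 = q - 1] is cancelled from the cyclotomic factorization of [q^N - 1]. *)
Lemma prod_cycloP N : (0 < N)%N ->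
  \prod_(e <- divisors N | e != 1%N) cycloP e = \sum_(i < N) qP ^+ i.
Proof.
have q1 : qP - 1 != 0 by rewrite monic_neq0 // monicXsubC.
have all_div M : (0 < M)%N -> \prod_(e <- divisors M) cycloP e = qP ^+ M - 1.
  move=> M0; rewrite /cycloP /liftq -(rmorph_prod (map_poly polyC)) -(rmorph_prod (map_poly intr)).
  by rewrite prod_Cyclotomic // !rmorphB !rmorphXn /= !map_polyX !rmorph1.
move=> N0; apply: (mulfI q1); rewrite -subrX1 -all_div //.
rewrite [RHS](bigD1_seq 1%N) ?divisors_uniq //= -?dvdn_divisors ?dvd1n //.
by congr (_ * _); have := all_div 1%N isT; rewrite big_seq1 => ->.
Qed.

(** * The list of prime factors and their places *)

Section Places.
Variable n : nat.
Hypothesis n_gt0 : (0 < n)%N.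

Definition place_index := (nat + nat * bool)%type.

Definition prime_factor (i : place_index) : Pqa :=
  match i with
  | inl e => cycloP e
  | inr (j, b) => if b then 1 - aP * qP ^+ ((2 * j + 1) * n)
                  else aP - qP ^+ ((2 * j + 1) * n)
  end.

Definition place (i : place_index) : {rmorphism Pqa -> Lt} :=
  match i with
  | inl e => specialize tL (constL (zeta e))
  | inr (j, b) => specialize (a_place tL b ((2 * j + 1) * n)) tL
  end.

Lemma place_ker i N : place i N = 0 -> pdivides (prime_factor i) N.
Proof.
case: i => [[|e]|[j b]].
(* ['Phi_0] is 1 by convention, so the index [inl 0] divides everything; the later lemmas exclude
   it. *)
- by exists N; rewrite /prime_factor /cycloP Cyclotomic0 /liftq !rmorph1 mul1r.
- exact: ker_cyclo (zeta_prim _).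
case: b; last exact: ker_a_sub_q.
by apply: ker_one_sub_aq; rewrite muln_gt0 n_gt0 addn1.
Qed.

Lemma specialize_one_sub al be m :
  specialize al be (1 - aP * qP ^+ m) = 1 - al * be ^+ m.
Proof. by rewrite rmorphB rmorph1 rmorphM rmorphXn specialize_a specialize_q. Qed.

Lemma specialize_sub al be m : specialize al be (aP - qP ^+ m) = al - be ^+ m.
Proof. by rewrite rmorphB rmorphXn specialize_a specialize_q. Qed.

Lemma place_prime_factor i : i != inl 0%N -> place i (prime_factor i) = 0.
Proof.
case: i => [[|e]|[j []]] // _; rewrite /place /prime_factor.
- by apply/eqP; rewrite root_cycloP // zeta_prim.
- by rewrite specialize_one_sub (mulVf (expf_neq0 _ tL_neq0)) subrr.
by rewrite specialize_sub subrr.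
Qed.

(** Cyclotomic factors are separated by the order of the root, mixed pairs by the transcendence of
    [t] over the constants, and two factors in [a] by comparing exponents of [t]. *)
Lemma place_separated i j : i != inl 0%N -> j != inl 0%N -> i != j ->
  place i (prime_factor j) != 0.
Proof.
case: i => [[|e]|[i b]]; case: j => [[|e']|[j b']] // _ _ ij; rewrite /place /prime_factor.
- rewrite root_cycloP //; apply: contra ij => /prim_order_inj.
  by move=> /(_ _ (zeta_prim (ltn0Sn e))) ->.
- case: b' {ij}; first by rewrite specialize_one_sub constLX one_sub_t_const.
  by rewrite specialize_sub constLX t_sub_const.
- rewrite specialize_liftq_t tofrac_eq0.
  by rewrite !monic_neq0 // !monic_map ?Cyclotomic_monic.
have exp_neq : (i != j) -> ((2 * i + 1) * n != (2 * j + 1) * n)%N.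
  by apply: contra; rewrite eqn_pmul2r // eqn_add2r eqn_pmul2l.
have pos : (0 < (2 * j + 1) * n)%N by rewrite muln_gt0 n_gt0 addn1.
case: b' ij => ij; rewrite ?specialize_one_sub ?specialize_sub.
  apply: (one_sub_a_place_neq0 tL_neq0 tL_free pos) => hb; apply: exp_neq.
  by apply: contra ij => /eqP ->; rewrite hb.
apply: (a_place_sub_neq0 tL_neq0 tL_free pos) => hb; apply: exp_neq.
by apply: contra ij => /eqP ->; rewrite (negPf hb).
Qed.

Lemma prime_factor_neq0 i : prime_factor i != 0.
Proof.
case: i => [e|[j b]]; first exact: monic_neq0 (cycloP_monic e).
(* A nonzero value at one place suffices, and [inl 1] differs from every index [inr]. *)
apply: (@phi_neq0 _ _ (place (inl 1%N))).
exact: place_separated.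
Qed.

Definition places r J : seq place_index :=
  [seq inl e | e <- [seq e <- divisors (n ^ r) | e != 1%N]]
  ++ [seq inr (j, true) | j <- iota 0 J] ++ [seq inr (j, false) | j <- iota 0 J].

Lemma places_uniq r J : uniq (places r J).
Proof.
rewrite /places !cat_uniq !map_inj_uniq ?iota_uniq ?filter_uniq ?divisors_uniq //;
  try by move=> ? ? [].
rewrite andbT /=; apply/andP; split.
  by apply/hasPn => x; rewrite mem_cat => /orP[] /mapP[j _ ->]; apply/mapP => -[].
by apply/hasPn => x /mapP[j _ ->]; apply/mapP => -[].
Qed.

Lemma prod_places r J : \prod_(i <- places r J) prime_factor i =
  (\sum_(i < n ^ r) qP ^+ i) *
  \prod_(j < J) ((1 - aP * qP ^+ ((2 * j + 1) * n)) * (aP - qP ^+ ((2 * j + 1) * n))).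
Proof.
rewrite !big_cat !big_map big_filter prod_cycloP ?expn_gt0 ?n_gt0 //; congr (_ * _).
rewrite -[J in iota 0 J]subn0 -/(index_iota 0 J) !big_mkord [RHS]big_split.
by [].
Qed.

Lemma mem_places r J (i : place_index) : i \in places r J ->
  match i with
  | inl e => [/\ e %| n ^ r, e != 1 & 0 < e]%N
  | inr (j, _) => (j < J)%N
  end.
Proof.
rewrite !mem_cat => /orP[/mapP[e]|/orP[] /mapP[j]]; last 2 first.
- by rewrite mem_iota => /andP[_ ?] ->.
- by rewrite mem_iota => /andP[_ ?] ->.
rewrite mem_filter -dvdn_divisors ?expn_gt0 ?n_gt0 // => /andP[e1 de] ->.
by split=> //; apply: dvdn_gt0 de; rewrite expn_gt0 n_gt0.
Qed.

End Places.

(** * Both sides at each place *)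

Section Congruence.
Variables n r d : nat.
Hypotheses (n_odd : odd n) (r_gt0 : (1 <= r)%N) (d12 : (d = 1 \/ d = 2)%N).

Lemma odd_dvd_double e m : odd m -> (e %| m)%N -> e = (e./2).*2.+1.
Proof.
move=> om /dvdnP[k Em]; have /andP[_ oe] : odd k && odd e by rewrite -oddM -Em.
by rewrite -{1}(odd_double_half e) oe.
Qed.

Let n_gt0 : (0 < n)%N. Proof. by case: n n_odd. Qed.

Lemma lhs_at_zeta e : (e %| n ^ r)%N -> e != 1%N -> (0 < e)%N ->
  specializes (specialize tL (constL (zeta e))) (qsum qK ((n ^ r - 1) %/ d)) 0.
Proof.
move=> de e1 e0; have onr : odd (n ^ r) by rewrite oddX n_odd orbT.
have E := odd_dvd_double onr de.
rewrite -{1}[qK]expr1; apply: (@specializes_qsum_zeta _ _ e./2) => //.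
- by rewrite -E expr1; apply: zeta_prim.
- by case: posnP => // h0; move: e1; rewrite E h0.
by rewrite -E.
Qed.

Lemma rhs_at_zeta e : (e %| n ^ r)%N -> e != 1%N -> (0 < e)%N ->
  specializes (specialize tL (constL (zeta e)))
    (qK ^- ((n - 1) %/ 2) * qint qK n * qsum (qK ^+ n) ((n ^ r.-1 - 1) %/ d)) 0.
Proof.
move=> de e1 e0; set z := zeta e; have ze : e.-primitive_root z := zeta_prim e0.
have z1 : z != 1.
  by rewrite -[z]expr1 -(prim_order_dvd ze) dvdn1.
have z0 : z != 0.
  apply/eqP => E; have := prim_expr_order ze.
  by rewrite E expr0n eqn0Ngt e0 => /eqP; rewrite eq_sym oner_eq0.
have qpow : specializes (specialize tL (constL z)) (qK ^- ((n - 1) %/ 2))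
    (constL z ^- ((n - 1) %/ 2)).
  apply: specializesV; last exact: specializesX (specializes_qK _ _).
  by apply: expf_neq0; rewrite tofrac_eq0 polyC_eq0.
have onr : odd (n ^ r.-1) by rewrite oddX n_odd orbT.
have zn1 : (z ^+ n) ^+ (n ^ r.-1) = 1.
  by rewrite -exprM -expnS prednK //; apply/eqP; rewrite -(prim_order_dvd ze).
(* [e'] is the order of [z ^+ n]. It divides [n ^ r.-1], so it is odd. *)
have [|e' ze' de'] := prim_order_exists _ zn1; first by rewrite expn_gt0 n_gt0.
have E := odd_dvd_double onr de'; rewrite E in ze'.
have qn := specializes_qint tL (constL z) n.
(* If [e' > 1] the sum over base [q^n] vanishes. If [e' = 1], then [[n]] vanishes because [z != 1],
   and the sum is finite. *)
have [h0|h0] := posnP e'./2; last first.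
  rewrite -[X in specializes _ _ X](mulr0
    (constL z ^- ((n - 1) %/ 2) * \sum_(i < n) constL z ^+ i)).
  apply: specializesM; first exact: specializesM.
  by apply: (specializes_qsum_zeta n_gt0 ze') => //; rewrite -E.
have [v hv] := qsum_regular n_gt0 ze' ((n ^ r.-1 - 1) %/ d).
have zn : z ^+ n = 1 by have := prim_expr_order ze'; rewrite h0 expr1.
have qn0 : \sum_(i < n) constL z ^+ i = 0.
  rewrite geometric_quotient; first by rewrite constLX zn /constL polyC1 tofrac1 subrr mul0r.
  by rewrite /constL -tofrac1 -tofracB tofrac_eq0 -polyC1 -polyCB polyC_eq0 subr_eq0 eq_sym.
rewrite qn0 in qn.
rewrite -[X in specializes _ _ X](mul0r v) -[X in X * v](mulr0 (constL z ^- ((n - 1) %/ 2))).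
by apply: specializesM => //; apply: specializesM.
Qed.

Lemma a_place_values_agree (F : fieldType) (t : F) j k m :
  t != 0 -> 1 - t != 0 -> 1 - t ^+ n != 0 ->
  t ^- k * ((1 - t ^+ n) / (1 - t)) * (t ^- (n * j) * (1 - t ^+ m) / (1 - t ^+ n))
  = t ^- (n * j + k) * (1 - t ^+ m) / (1 - t).
Proof.
move=> t0 t1; rewrite exprD; have := expf_neq0 k t0; have := expf_neq0 (n * j) t0.
move: (t ^+ k) (t ^+ (n * j)) (t ^+ m) (t ^+ n) => x y z w x0 y0 w0.
by field; rewrite t1 w0 x0 y0.
Qed.

Lemma difference_at_a_place j b : (j <= (n ^ r.-1 - 1) %/ d)%N ->
  specializes (specialize (a_place tL b ((2 * j + 1) * n)) tL)
    (qsum qK ((n ^ r - 1) %/ d)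
     - qK ^- ((n - 1) %/ 2) * qint qK n * qsum (qK ^+ n) ((n ^ r.-1 - 1) %/ d)) 0.
Proof.
move=> jN; set k := ((n - 1) %/ 2)%N; set m := ((2 * j + 1) * n)%N.
have En : (n = 2 * k + 1)%N.
  by have := odd_double_half n; rewrite n_odd /k; lia.
(* The exponent with index [j] in base [q^n] has index [n * j + k] in base [q]; the extra [k]
   accounts for the power of [q] on the right-hand side. *)
have Em : m = (1 * (2 * (n * j + k) + 1))%N by rewrite /m {1}En; lia.
(* The left sum is long enough to reach the index at which it terminates. *)
have jK : (n * j + k <= (n ^ r - 1) %/ d)%N.
  have nr0 : (0 < n ^ r.-1)%N by rewrite expn_gt0 n_gt0.
  have -> : (n ^ r = n * n ^ r.-1)%N by rewrite -expnS prednK.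
  move: jN; move: (n ^ r.-1)%N nr0 => x x0; case: d12 => ->.
    by rewrite !divn1; nia.
  by rewrite !leq_divRL //; nia.
have tn1 := one_sub_expf_neq0 tL_free n_gt0.
have t1 : 1 - tL != 0 := one_sub_expf_neq0 tL_free (ltn0Sn 0).
have lhs : specializes (specialize (a_place tL b m) tL) (qsum qK ((n ^ r - 1) %/ d))
    (tL ^- (n * j + k) * (1 - tL ^+ m) / (1 - tL)).
  by rewrite Em; have := @specializes_qsum_a b 1 (n * j + k) _ isT jK; rewrite !expr1 !mul1n.
have rhs := @specializes_qsum_a b n j _ n_odd jN.
rewrite [(n * (2 * j + 1))%N]mulnC -/m in rhs.
have qk : specializes (specialize (a_place tL b m) tL) (qK ^- k) (tL ^- k).
  apply: specializesV; last exact: specializesX (specializes_qK _ _).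
  exact: expf_neq0 tL_neq0.
have qn := specializes_qint (a_place tL b m) tL n.
rewrite (geometric_quotient _ t1) in qn.
have := specializesB lhs (specializesM (specializesM qk qn) rhs).
by rewrite (a_place_values_agree _ _ _ tL_neq0 t1 tn1) subrr.
Qed.

End Congruence.

Theorem theorem2p3 (n r d : nat) :
  (1 < n)%N -> odd n -> (1 <= r)%N -> (d = 1 \/ d = 2)%N ->
  congr_mod
    (qsum qK ((n ^ r - 1) %/ d))
    (qK ^- ((n - 1) %/ 2) * qint qK n * qsum (qK ^+ n) ((n ^ r.-1 - 1) %/ d))
    (modulus n r d).
Proof.
move=> n1 n_odd r0 d12; have n0 : (0 < n)%N by apply: ltnW.
rewrite /modulus; set J := (_ %/ d).+1.
rewrite -(prod_places n0 r J).
have nz i : i \in places n r J -> i != inl 0%N.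
  by move/(mem_places n0); case: i => [[|e]|[j b]] //= [].
(* [J] is a successor, so the index with [j = 0] always belongs to the list and shows it
   nonempty. *)
apply: (@congr_mod_prod _ _ (prime_factor n) (place n) _ _ _ _ _ (inr (0%N, true))).
- by move=> i N; apply: place_ker.
- by move=> i; apply: prime_factor_neq0.
- by rewrite !mem_cat orbCA map_f // mem_iota.
- exact: places_uniq.
- by move=> i j si sj; apply: place_separated; rewrite ?nz.
- by move=> i si; apply: place_prime_factor; apply: nz si.
move=> [e|[j b]] /(mem_places n0).
  move=> [de e1 e0]; rewrite -[X in specializes _ _ X](subr0 0).
  by apply: specializesB; [apply: lhs_at_zeta|apply: rhs_at_zeta].
by rewrite ltnS => jN; apply: difference_at_a_place.
Qed.
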